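(* Let $n$ be an odd integer, $n>3$, and let $G_t(x)=x^{2^t-1}$ over $\mathbb{F}_{2^n}$ with $t=(n-1)/2$. Then $G_t$ is a permutation of $\mathbb{F}_{2^n}$ and for all $b\in\mathbb{F}_{2^n}\setminus\mathbb{F}_2$ we have $\delta(b)\in\{0,2,6\}$. Moreover: - if $n\equiv 0\bmod 3$, then $\delta(G_t)=8$, and the differential spectrum satisfies $\omega_i=0$ for all $i\notin\{0,2,6,8\}$ and $\omega_8=1$; - if $n\not\equiv 0\bmod 3$, then $\delta(G_t)\le 6$ and the differential spectrum satisfies $\omega_i=0$ for all $i\notin\{0,2,6\}$.
   Context: For $b\in\mathbb{F}_{2^n}$, $\delta(b)=\#\{x\in\mathbb{F}_{2^n} : G_t(x+1)+G_t(x)=b\}$, and $\delta(G_t)=\max_{b\in\mathbb{F}_{2^n}}\delta(b)$. The differential spectrum is the family $\omega_i=\#\{b\in\mathbb{F}_{2^n} : \delta(b)=i\}$. *)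

(* Defs.v *)
From HB Require Import structures.
From mathcomp Require Import all_boot all_order all_algebra.

Set Implicit Arguments.
Unset Strict Implicit.
Unset Printing Implicit Defensive.

Import GRing.Theory.
Local Open Scope ring_scope.

Definition Gt (F : finFieldType) (t : nat) (x : F) : F := x ^+ (2 ^ t - 1).

(* The differences are taken in direction 1 only, which loses nothing for
   power maps; in characteristic 2, the sum below is the difference. *)
Definition delta (F : finFieldType) (G : F -> F) (b : F) : nat :=
  #|[set x : F | G (x + 1) + G x == b]|.

Definition delta_max (F : finFieldType) (G : F -> F) : nat :=
  (\max_(b : F) delta G b)%N.

Definition omega (F : finFieldType) (G : F -> F) (i : nat) : nat :=
  #|[set b : F | delta G b == i]|.

(* Main.v *)
Require Import Defs.
From mathcomp Require Import all_boot all_order all_algebra.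
From mathcomp Require Import fingroup finfield.
From mathcomp Require Import zify ring.

(* Put [q = 2 ^ t], so that [n = 2 t + 1] and [x ^ (2 q ^ 2) = x] on [F].
   Multiplying [G (x + 1) + G x = b] by [x (x + 1)] turns it into
   [x ^ q = b x ^ 2 + (b + 1) x], whose solutions form an additive subgroup
   [K_b] containing the two spurious solutions [0] and [1], which are genuine
   only for [b = 1].  Raising that equation to the power [2 q] and substituting
   it into the result leaves a nonzero polynomial equation of degree at most 8
   for [x], hence [#|K_b|] is 2, 4 or 8.  For [b = 1] the equation of degree 8
   is [x ^ 8 = x], which defines the intersection of [F] with the field with 8
   elements. *)

Import GRing.Theory.
Local Open Scope ring_scope.

Lemma exprD_pow2 (R : comNzRingType) (k : nat) (x y : R) :
  2 \in [pchar R] -> (x + y) ^+ (2 ^ k) = x ^+ (2 ^ k) + y ^+ (2 ^ k).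
Proof. by move=> ch2; rewrite exprDn_pchar// pnatX pnatE// ch2. Qed.

(** As ['X^d - 1] divides ['X^(#|F|.-1) - 1], the polynomial ['X^(d.+1) - 'X] divides the product of
    all ['X - x%:P]. It is thus itself a product of distinct linear factors, with as many roots as
    its degree. *)
Lemma card_expf_fix (F : finFieldType) (d : nat) :
  (0 < d)%N -> (d %| #|F|.-1)%N -> #|[set x : F | x ^+ d.+1 == x]| = d.+1.
Proof.
move=> d_gt0 /dvdnP[m dm]; pose p : {poly F} := 'X^(d.+1) - 'X.
have size_p : size p = d.+2.
  by rewrite size_polyDl size_polyXn// size_polyN size_polyX.
have : p %| \prod_(x <- index_enum F) ('X - x%:P).
  rewrite -finField_genPoly -(prednK (ltnW (card_finNzRing_gt1 F))) dm /p.
  rewrite mulnC !exprS exprM -[X in _ %| _ - X]mulr1 -[X in _ - X %| _]mulr1.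
  rewrite -!mulrBr dvdp_mul2l ?polyX_eq0// [X in _ %| X]subrX1.
  exact: dvdp_mulIl.
case/dvdp_prod_XsubC => mk; set s := mask mk _ => p_s.
have size_s : size s = d.+1.
  by apply: succn_inj; rewrite -size_p (eqp_size p_s) size_prod_XsubC.
rewrite -[RHS]size_s -(card_uniqP (mask_uniq (index_enum_uniq F) mk)).
apply: eq_card => x.
by rewrite inE -root_prod_XsubC -(eqp_root p_s) rootE !hornerE subr_eq0.
Qed.

Definition diff_kernel {F : finFieldType} (t : nat) (b : F) : {set F} :=
  [set x | x ^+ (2 ^ t) == b * x ^+ 2 + (b + 1) * x].

Section Char2.

Variables (F : finFieldType) (t : nat).
Hypothesis ch2 : 2 \in [pchar F].

Lemma diff_kernel01 (b : F) : [set 0; 1] \subset diff_kernel t b.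
Proof.
apply/subsetP => x; rewrite !inE => /orP[] /eqP->.
  by rewrite !expr0n expn_eq0/= !mulr0 addr0.
by rewrite !expr1n !mulr1 addrA addrr_pchar2// add0r.
Qed.

Lemma delta_Gt (b : F) : (0 < t)%N ->
  delta (@Gt F t) b =
    if b == 1 then #|diff_kernel t b| else (#|diff_kernel t b| - 2)%N.
Proof.
move=> t_gt0.
have q_gt1 : (1 < 2 ^ t)%N by rewrite -{1}(expn0 2) ltn_exp2l.
have GtE x : x * Gt t x = x ^+ (2 ^ t) by rewrite /Gt -exprS; congr (_ ^+ _); lia.
(* The exponent is nonzero because [t] is positive; otherwise [0 ^+ 0] would be 1. *)
have Gt0 : Gt t (0 : F) = 0 by rewrite /Gt expr0n; case: eqP => //; lia.
have Gt1 : Gt t (1 : F) = 1 by rewrite /Gt expr1n.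
have at0 : (Gt t (0 + 1 : F) + Gt t 0 == b) = (b == 1).
  by rewrite add0r Gt0 Gt1 addr0 eq_sym.
have at1 : (Gt t (1 + 1 : F) + Gt t 1 == b) = (b == 1).
  by rewrite addrr_pchar2// Gt0 Gt1 add0r eq_sym.
have generic x : x != 0 -> x != 1 ->
    (Gt t (x + 1) + Gt t x == b) = (x \in diff_kernel t b).
  move=> x0 x1; have x1' : x + 1 != 0.
    by rewrite -(oppr_pchar2 ch2 1) subr_eq0.
  rewrite inE -subr_eq0 -(mulrI_eq0 _ (mulfI x1')) -(mulrI_eq0 _ (mulfI x0)).
  rewrite -[in RHS]subr_eq0; congr (_ == 0).
  have -> : x * ((x + 1) * (Gt t (x + 1) + Gt t x - b)) =
     x * ((x + 1) * Gt t (x + 1)) + (x + 1) * (x * Gt t x) - x * (x + 1) * b.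
    by ring.
  rewrite !GtE exprD_pow2// expr1n.
  (* The surplus over the kernel equation occurs twice, so characteristic 2 cancels it. *)
  have -> : x * (x ^+ (2 ^ t) + 1) + (x + 1) * x ^+ (2 ^ t) - x * (x + 1) * b =
     x ^+ (2 ^ t) - (b * x ^+ 2 + (b + 1) * x) +
     ((x + x * x ^+ (2 ^ t)) + (x + x * x ^+ (2 ^ t))) by ring.
  by rewrite addrr_pchar2// addr0.
have sub01 := subsetP (diff_kernel01 b).
case: eqP => [b1 | /eqP b1].
  apply: eq_card => x; rewrite inE.
  have [->|x0] := eqVneq x 0; first by rewrite at0 sub01 ?inE ?eqxx// b1 eqxx.
  have [->|x1] := eqVneq x 1; first by rewrite at1 sub01 ?inE ?eqxx ?orbT// b1 eqxx.
  exact: generic.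
have <- : #|[set 0; 1 : F]| = 2%N by rewrite cards2 eq_sym oner_eq0.
rewrite -(setIidPr (diff_kernel01 b)) -cardsD.
apply: eq_card => x; rewrite inE in_setD in_set2.
have [->|x0] := eqVneq x 0; first by rewrite at0 (negPf b1).
have [->|x1] := eqVneq x 1; first by rewrite at1 (negPf b1).
exact: generic.
Qed.

(** Both sides of the kernel equation are additive in [x], so Lagrange applies to the additive group
    of [F]. *)
Lemma dvdn_card_diff_kernel (b : F) : (#|diff_kernel t b| %| #|F|)%N.
Proof.
have gK : group_set (diff_kernel t b).
  apply/group_setP; split=> [|x y].
    by apply: (subsetP (diff_kernel01 b)); rewrite !inE eqxx.
  rewrite !inE => /eqP xK /eqP yK; rewrite FinRing.zmodMgE exprD_pow2// xK yK.
  by rewrite (@exprD_pow2 _ 1)// !mulrDr addrACA.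
rewrite -[#|F|]cardsT; apply: (@cardSg _ [set: F]%G (Group gK)).
exact: subsetT.
Qed.

End Char2.

Section OddDegree.

Variables (F : finFieldType) (t : nat).
Hypothesis cardF : #|F| = (2 ^ t.*2.+1)%N.

Lemma pchar2 : 2 \in [pchar F].
Proof. exact: card_finPcharP cardF _. Qed.

Lemma diff_kernel_poly (b x : F) : x \in diff_kernel t b ->
  let c := b ^+ (2 ^ t) in
  x = c ^+ 2 * b ^+ 4 * x ^+ 8
      + (c ^+ 2 * (b + 1) ^+ 4 + (c + 1) ^+ 2 * b ^+ 2) * x ^+ 4
      + (c + 1) ^+ 2 * (b + 1) ^+ 2 * x ^+ 2.
Proof.
have ch2 := pchar2; rewrite inE => /eqP xK c.
transitivity (((x ^+ (2 ^ t)) ^+ (2 ^ t)) ^+ 2).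
  by rewrite -!exprM -expnSr -expnD addnS addnn -cardF expf_card.
have -> : (x ^+ (2 ^ t)) ^+ (2 ^ t) =
    c * (x ^+ (2 ^ t)) ^+ 2 + (c + 1) * x ^+ (2 ^ t).
  by rewrite {1}xK exprD_pow2// !exprMn exprD_pow2// expr1n -/c.
have sqrD (u v y z : F) :
    (u * y + v * z) ^+ 2 = u ^+ 2 * y ^+ 2 + v ^+ 2 * z ^+ 2.
  by rewrite (@exprD_pow2 _ 1)//; ring.
by rewrite xK; move: (b + 1) (c + 1) => b1 c1; rewrite !sqrD; ring.
Qed.

Lemma card_diff_kernel_le8 (b : F) : (#|diff_kernel t b| <= 8)%N.
Proof.
pose c := b ^+ (2 ^ t).
pose p : {poly F} := Poly [:: 0; -1; (c + 1) ^+ 2 * (b + 1) ^+ 2; 0;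
  c ^+ 2 * (b + 1) ^+ 4 + (c + 1) ^+ 2 * b ^+ 2; 0; 0; 0; c ^+ 2 * b ^+ 4].
(* The leading coefficient may vanish, but that of ['X] is -1 for every [b]. *)
have p_neq0 : p != 0.
  apply/eqP => /(congr1 (fun r : {poly F} => r`_1)) /eqP.
  by rewrite coef_Poly coef0 oppr_eq0 oner_eq0.
have p_roots : all (root p) (enum (diff_kernel t b)).
  apply/allP => x; rewrite mem_enum => /diff_kernel_poly /esym /eqP.
  rewrite -subr_eq0 -/c rootE horner_Poly => /eqP xE; apply/eqP; rewrite -[RHS]xE /=.
  by ring.
(* The number of roots is strictly below the size of [p], which is at most 9. *)
have := max_poly_roots p_neq0 p_roots (enum_uniq _).
by rewrite -cardE => /leq_trans /(_ (size_Poly _)).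
Qed.

(** The cardinality is a power of 2, at least 2 because of the elements 0 and 1, and at most 8. *)
Lemma card_diff_kernel (b : F) : #|diff_kernel t b| \in [:: 2; 4; 8]%N.
Proof.
have := dvdn_card_diff_kernel F t pchar2 b; rewrite cardF.
have := card_diff_kernel_le8 b.
have := subset_leq_card (diff_kernel01 F t pchar2 b).
rewrite cards2 eq_sym oner_eq0 => ge2 le8 /dvdn_pfactor[//|k _ kE].
move: ge2 le8; rewrite kE -[8%N]/(2 ^ 3)%N -{1}(expn1 2) !leq_exp2l//.
by case: k {kE} => [|[|[|[|k]]]].
Qed.

Lemma card_diff_kernel1 :
  #|diff_kernel t (1 : F)| = if (3 %| t.*2.+1)%N then 8%N else 2%N.
Proof.
have ch2 := pchar2.
have mem1 x : (x \in diff_kernel t (1 : F)) = (x ^+ (2 ^ t) == x ^+ 2).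
  by rewrite inE addrr_pchar2// mul0r mul1r addr0.
have fix8 x : x \in diff_kernel t (1 : F) -> x ^+ 8 = x.
  move=> /diff_kernel_poly xE; rewrite [RHS]xE expr1n addrr_pchar2//.
  by ring.
have iter8 (x : F) k : x ^+ 8 = x -> x ^+ (2 ^ (3 * k)) = x.
  move=> x8; rewrite expnM; elim: k => [|k IHk]; first by rewrite expr1.
  by rewrite expnSr exprM IHk.
have fixF (x : F) : x ^+ (2 ^ t.*2.+1) = x by rewrite -cardF expf_card.
case: ifP => [/dvdnP[m mE] | n3].
  rewrite -[8%N](@card_expf_fix F 7)//; last first.
    by rewrite cardF mE mulnC expnM predn_exp dvdn_mulr.
  apply: eq_card => x; rewrite mem1 inE; apply/idP/idP.
    by rewrite -mem1 => /fix8 ->.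
  (* Since 3 divides [2 t + 1], [t] is 1 modulo 3, so [x ^+ 8 = x] reduces [x ^+ (2 ^ t)] to
     [x ^+ 2]. *)
  move=> /eqP /iter8 x8; have -> : t = (3 * (t %/ 3) + 1)%N by lia.
  by rewrite expnD exprM x8.
have <- : #|[set 0; 1 : F]| = 2%N by rewrite cards2 eq_sym oner_eq0.
apply/esym/eq_card/subset_eqP/andP; split; first exact: diff_kernel01.
apply/subsetP => x /fix8 x8.
suff /eqP : x ^+ 2 = x.
  rewrite -subr_eq0 expr2 -[X in _ - X]mulr1 -mulrBr mulf_eq0 subr_eq0.
  by rewrite !inE.
(* Reducing the exponent of 2 modulo 3 in [fixF] gives [x ^+ 2 = x] or [x ^+ 4 = x]; in the latter
   case [x = x ^+ 8 = (x ^+ 4) ^+ 2 = x ^+ 2]. *)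
have [n1|n2] : (t.*2.+1 = 3 * (t.*2.+1 %/ 3) + 1 \/
                t.*2.+1 = 3 * (t.*2.+1 %/ 3) + 2)%N by lia.
  by have := fixF x; rewrite n1 expnD exprM iter8.
have x4 : x ^+ 4 = x by have := fixF x; rewrite n2 expnD exprM iter8.
by rewrite -[RHS]x8 (exprM x 4 2) x4.
Qed.

(** For nonzero [y], the quotient [z = x / y] satisfies [z ^+ e = 1], hence [z ^+ q = z] with
    [q = e + 1]. Then [z = z ^+ (2 q ^ 2) = z ^+ 2], which forces [z = 1]. *)
Lemma Gt_inj : (0 < t)%N -> injective (@Gt F t).
Proof.
move=> t_gt0; pose e := (2 ^ t - 1)%N.
have eE : (2 ^ t = e.+1)%N by rewrite /e; have := expn_gt0 2 t; lia.
have e_gt0 : (0 < e)%N.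
  by rewrite /e subn_gt0 -{1}(expn0 2) ltn_exp2l.
have only1 (z : F) : z ^+ e = 1 -> z = 1.
  move=> ze; have zq : z ^+ (2 ^ t) = z by rewrite eE exprS ze mulr1.
  have z2 : z ^+ 2 = z.
    have := expf_card z; rewrite cardF -addnn -addnS expnD expnSr !exprM.
    by rewrite !zq.
  have z0 : z != 0.
    apply: contra_eq_neq ze => ->.
    by rewrite expr0n -[e]prednK//= eq_sym oner_eq0.
  by apply: (mulfI z0); rewrite mulr1 -expr2.
move=> x y; rewrite /Gt -/e => xy.
have [y0|y0] := eqVneq y 0.
  move/eqP: xy; rewrite y0 expr0n -[e in (e == 0)%N]prednK//=.
  by rewrite expf_eq0 e_gt0 => /eqP.
apply: (divIf y0); rewrite divff//; apply: only1.
by rewrite expr_div_n xy divff// expf_eq0 e_gt0.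
Qed.

End OddDegree.

Theorem theorem9 (n : nat) (n_odd : odd n) (n_gt3 : (3 < n)%N)
    (F : finFieldType) (cardF : #|F| = (2 ^ n)%N) :
  let G : F -> F := @Gt F ((n - 1) %/ 2)%N in
  [/\ bijective G,
      forall b : F, b \notin [set 0; 1] -> delta G b \in [:: 0; 2; 6]%N,
      (n = 0 %[mod 3])%N ->
        [/\ delta_max G = 8%N,
            forall i : nat, i \notin [:: 0; 2; 6; 8]%N -> omega G i = 0%N
          & omega G 8 = 1%N]
    & (n <> 0 %[mod 3])%N ->
        (delta_max G <= 6)%N /\
        forall i : nat, i \notin [:: 0; 2; 6]%N -> omega G i = 0%N].
Proof.
set t := ((n - 1) %/ 2)%N => G.
have nE : n = t.*2.+1 by rewrite /t; lia.
have t_gt0 : (0 < t)%N by lia.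
rewrite nE in cardF *; have ch2 := pchar2 F t cardF.
have delta1 : delta G 1 = if (3 %| t.*2.+1)%N then 8%N else 2%N.
  by rewrite delta_Gt// eqxx card_diff_kernel1.
(* Removing the spurious solutions 0 and 1 turns the kernel sizes 2, 4, 8 into 0, 2, 6. *)
have deltaN1 b : b != 1 -> delta G b \in [:: 0; 2; 6]%N.
  move=> /negPf b1; rewrite delta_Gt// b1.
  have := card_diff_kernel F t cardF b.
  by rewrite !inE => /or3P[] /eqP ->.
have omega0 (s : seq nat) i :
    (forall b, delta G b \in s) -> i \notin s -> omega G i = 0%N.
  move=> ds si; apply/eqP; rewrite cards_eq0; apply/eqP/setP => b.
  by rewrite !inE; apply/negP => /eqP bi; rewrite -bi ds in si.
split.
- exact: injF_bij (Gt_inj F t cardF t_gt0).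
- by move=> b; rewrite in_set2 negb_or => /andP[_ /deltaN1].
- rewrite mod0n => /eqP n3; rewrite -/(dvdn _ _) in n3.
  rewrite n3 in delta1.
  have delta8 b : delta G b \in [:: 0; 2; 6; 8]%N.
    have [->|/deltaN1] := eqVneq b 1; first by rewrite delta1.
    by rewrite !inE => /or3P[] ->; rewrite ?orbT.
  split; last 2 first.
  + by move=> i; exact: omega0 delta8.
  (* The value 8 is attained at [b = 1] and nowhere else. *)
  + rewrite /omega -[RHS](cards1 (1 : F)); apply: eq_card => b; rewrite !inE.
    have [->|/deltaN1] := eqVneq b 1; first by rewrite delta1.
    by rewrite !inE => /or3P[] /eqP ->.
  + apply/eqP; rewrite eqn_leq; apply/andP; split.
      apply/bigmax_leqP => b _; move: (delta8 b).
      by rewrite !inE => /or4P[] /eqP ->.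
    by rewrite -delta1; apply: leq_bigmax.
- rewrite mod0n => /eqP n3; rewrite -/(dvdn _ _) in n3.
  rewrite (negPf n3) in delta1.
  have delta6 b : delta G b \in [:: 0; 2; 6]%N.
    by have [->|/deltaN1//] := eqVneq b 1; rewrite delta1.
  split; last by move=> i; exact: omega0 delta6.
  apply/bigmax_leqP => b _; move: (delta6 b).
  by rewrite !inE => /or3P[] /eqP ->.
Qed.
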